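(* For every integer $k\ge 1$ there exists an oracle $\mathcal{A}$ such that $\mathrm{UP}_{\le k+1}^{\mathcal{A}}\not\subseteq \mathrm{U}\Sigma^{p,\mathcal{A}}_k$.
   Context: Alphabet $\{0,1\}$. For an oracle $A$ and $h\ge1$, $\mathrm{UP}_{\le h}^{A}$ is the class of sets accepted by a nondeterministic polynomial-time oracle Turing machine with oracle $A$ that has at most $h$ accepting paths on every input. A $\Sigma_k(A)$-system $[A;N_1,\dots,N_k]$ consists of $A$ and nondeterministic polynomial-time oracle Turing machines $N_1,\dots,N_k$; its language is $L[A;N_1]=L(N_1^A)$ and $L[A;N_1,\dots,N_k]=L(N_1^{L[A;N_2,\dots,N_k]})$ for $k>1$; its computation on $x$ is the computation of $N_1$ on $x$ with oracle $A$ (if $k=1$) or $L[A;N_2,\dots,N_k]$ (if $k>1$). The system is unambiguous if for every $1\le i\le k$ and every input $y$, the computation $[A;N_i,\dots,N_k](y)$ has at most one accepting path. $\mathrm{U}\Sigma^{p,A}_0=\mathrm{P}^A$, and for $k\ge1$, $\mathrm{U}\Sigma^{p,A}_k$ (the $k$-th level of the relativized unambiguous polynomial hierarchy, $\mathrm{UP}^{\mathrm{U}\Sigma^{p,A}_{k-1}}$) is the class of languages $L[A;N_1,\dots,N_k]$ of unambiguous $\Sigma_k(A)$-systems. *)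

(* Defs.v *)
From mathcomp Require Import all_boot all_algebra.
From mathcomp Require Import all_classical.

Set Implicit Arguments.
Unset Strict Implicit.
Unset Printing Implicit Defensive.

Local Open Scope classical_set_scope.
Local Open Scope card_scope.

Notation word := (seq bool).
Notation language := (set word).

(* Nondeterministic oracle Turing machines with finitely many one-way infinite
   tapes: tape [ord0] holds the input, tape [ord_max] is the query tape and
   there are [work] further work tapes.  States are numbered, so that machines
   form a small type.  Tape symbols are the blank [None], the input bits
   [Some (inl b)] and [aux] auxiliary symbols [Some (inr i)].  A head move is
   [None] (stay), [Some false] (left) or [Some true] (right).  The transition
   table gives the set of instructions applicable to a state and a tuple of
   scanned symbols; it is not consulted in the states [accept] and [query]. *)
Definition symbol (aux : nat) := option (bool + 'I_aux).

Record oracle_machine := OracleMachine {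
  work : nat;
  aux : nat;
  nstates : nat;
  start : 'I_nstates;
  accept : 'I_nstates;
  query : 'I_nstates;
  yes : 'I_nstates;
  no : 'I_nstates;
  delta : {ffun 'I_nstates * {ffun 'I_work.+2 -> symbol aux} ->
           {set 'I_nstates *
                {ffun 'I_work.+2 -> symbol aux * option bool}}}
}.

Section Computation.
Variable M : oracle_machine.

Notation tape_index := ('I_(work M).+2).
Notation sym := (symbol (aux M)).

(* A tape is its written part, from cell 0 and blank beyond its end, together
   with the head position. *)
Definition config := ('I_(nstates M) * {ffun tape_index -> seq sym * nat})%type.

Definition init (x : word) : config :=
  (start M, [ffun i : tape_index =>
               (if i == ord0 then [seq Some (inl b) : sym | b <- x] else [::],
                0)]).

Definition scan (c : config) : {ffun tape_index -> sym} :=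
  [ffun i => nth None (c.2 i).1 (c.2 i).2].

(* A left move in cell 0 leaves the head in place. *)
Definition move (d : option bool) (h : nat) : nat :=
  match d with None => h | Some false => h.-1 | Some true => h.+1 end.

Definition act (c : config)
    (a : 'I_(nstates M) * {ffun tape_index -> sym * option bool}) : config :=
  (a.1, [ffun i => (set_nth None (c.2 i).1 (c.2 i).2 (a.2 i).1,
                    move (a.2 i).2 (c.2 i).2)]).

Fixpoint bit_prefix (s : seq sym) : word :=
  if s is Some (inl b) :: s' then b :: bit_prefix s' else [::].

(* The queried word is the longest block of bits from cell 0 on the query
   tape; a query costs one step and leaves all tapes unchanged. *)
Definition query_word (c : config) : word := bit_prefix (c.2 ord_max).1.

(* Configurations in state [accept] and those without applicable instruction
   are halting; among them exactly the former are accepting. *)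
Definition step (A : language) (c c' : config) : bool :=
  if c.1 == accept M then false
  else if c.1 == query M then
    c' == (if query_word c \in A then yes M else no M, c.2)
  else [exists a in delta M (c.1, scan c), c' == act c a].

Definition accepting_paths (A : language) (x : word) : set (seq config) :=
  [set p | path (step A) (init x) p /\ (last (init x) p).1 = accept M].

Definition lang (A : language) : language :=
  [set x | accepting_paths A x !=set0].

(* The bound holds for all computation paths, relative to every oracle. *)
Definition poly_time : Prop :=
  exists p : {poly nat}, forall (A : language) (x : word) (c : seq config),
    path (step A) (init x) c -> size c <= p.[size x]%R.

Definition deterministic : Prop := forall qs, #|delta M qs| <= 1.

End Computation.

Arguments accepting_paths : clear implicits.

Record poly_machine := PolyMachine {
  machine :> oracle_machine;
  machine_poly_time : poly_time machine
}.

Definition at_most_paths (h : nat) (A : language) (N : oracle_machine) : Prop :=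
  forall x : word, accepting_paths N A x #<= `I_h.

Definition UP_le (h : nat) (A : language) : set language :=
  [set L | exists N : poly_machine, at_most_paths h A N /\ L = lang N A].

(* The language of the system [A; N_1, ..., N_k], extended by [A] itself for
   the empty list of machines. *)
Fixpoint sys_lang (A : language) (Ns : seq poly_machine) : language :=
  if Ns is N :: Ns' then lang N (sys_lang A Ns') else A.

Fixpoint unambiguous (A : language) (Ns : seq poly_machine) : Prop :=
  if Ns is N :: Ns' then
    at_most_paths 1 (sys_lang A Ns') N /\ unambiguous A Ns'
  else True.

Definition P_class (A : language) : set language :=
  [set L | exists N : poly_machine, deterministic N /\ L = lang N A].

Definition USigma (k : nat) (A : language) : set language :=
  if k is 0 then P_class A
  else [set L | exists Ns : k.-tuple poly_machine,
                  unambiguous A Ns /\ L = sys_lang A Ns].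

(* Main.v *)
(* Call a word [a] sensitive for a system on input [y] at oracle [A] if adding
   [a] to [A] changes the answer on [y].  If a [k]-machine system stays
   unambiguous under the addition of up to [k + 1] words, then only polynomially
   many words are sensitive, by induction on [k].  If [y] is accepted, a
   sensitive word must be sensitive for one of the queries on the accepting
   path.  If [y] is rejected, every sensitive [a] yields an accepting path
   [pi a] at [A + a], and few words are sensitive at [A + a] for the queries on
   [pi a].  If neither of [a], [b] is sensitive for the queries on the other's
   path, both paths accept at [A + a + b], so [pi a = pi b]; and [a] must be
   sensitive at [A] for the queries on that path, or it would accept at [A].
   So all but few [a] lie in one small set, after choosing a suitable [b].

   The machine that guesses a word of the length of its input and queries it has
   as many accepting paths as the oracle has words of that length, and at the
   empty slice all [2 ^ n] words of length [n] are sensitive for it; hence no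
   system agrees with it for all slices of at most [k + 1] words, and a
   finite-extension diagonalisation over all systems gives the oracle. *)

Require Import Defs.
From mathcomp Require Import all_boot all_algebra.
From mathcomp Require Import all_classical.
From mathcomp Require Import zify.

Set Implicit Arguments.
Unset Strict Implicit.
Unset Printing Implicit Defensive.

Local Open Scope classical_set_scope.
Local Open Scope card_scope.

(** * Polynomial and exponential bounds *)

Lemma horner_nat_le_expn (p : {poly nat}) :
  exists c, forall n : nat, p.[n]%R <= n.+2 ^ c.
Proof.
elim/poly_ind: p => [|p a [d le_d]].
  by exists 0 => n; rewrite horner0.
exists (d + a).+1 => n; rewrite hornerMXaddC.
change (p.[n]%R * n + a <= n.+2 ^ (d + a).+1).
rewrite expnS expnD.
have lt_a : a < n.+2 ^ a by apply: ltn_expl.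
have X_gt0 : 0 < n.+2 ^ d by rewrite expn_gt0.
apply: leq_trans (leq_add (leq_mul (le_d n) (leqnn n)) (ltnW lt_a)) _.
set X := n.+2 ^ d in X_gt0 *; set Y := n.+2 ^ a in lt_a *.
have [leX leY] : X <= X * Y /\ Y <= X * Y by split; nia.
have : X * n <= X * Y * n by rewrite leq_mul2r leX orbT.
nia.
Qed.

Lemma leq_expn2r c m n : m <= n -> m ^ c <= n ^ c.
Proof. by case: c => // c le_mn; rewrite leq_exp2r. Qed.

Lemma expn_lt_exp2 c m : exists2 n, m <= n & n.+2 ^ c < 2 ^ n.
Proof.
(* For [n = 2 ^ (3 * u)] one has [n + 2 <= 2 ^ (3 * u + 1)], so [c * (3 * u + 1) < 2 ^ (3 * u)]
   suffices; [(u + 1) ^ 3] lies between the two. *)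
set u := (c + m).+1; exists (2 ^ (3 * u)).
  by apply: leq_trans (ltnW (ltn_expl _ _)) => //; lia.
apply: (@leq_ltn_trans ((2 ^ (3 * u).+1) ^ c)).
  apply: leq_expn2r; rewrite expnS.
  have : 3 * u < 2 ^ (3 * u) by apply: ltn_expl.
  lia.
rewrite -expnM ltn_exp2l // mulnC.
apply: (@leq_trans (u.+1 ^ 3)); first by rewrite !expnS expn0; nia.
by rewrite (mulnC 3) expnM leq_exp2r // ltn_expl.
Qed.

Lemma path_bound (N : poly_machine) : exists c, forall A x p,
  path (@step N A) (init N x) p -> size p < (size x).+2 ^ c.
Proof.
have [p le_p] := machine_poly_time N; have [c le_c] := horner_nat_le_expn p.
(* The base is at least 2 even on the empty input, so one more factor makes the bound strict. *)
exists c.+1 => A x s /le_p le_s.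
apply: leq_ltn_trans (leq_trans le_s (le_c _)) _.
by rewrite ltn_exp2l.
Qed.

(** * Runs depend on a finite part of the oracle *)

Section Queries.
Variable M : oracle_machine.
Implicit Types (A : language) (c : config M) (p : seq (config M)).

(** Every configuration contributes its query tape, in state [query] or not, so this list contains
    all words actually asked. *)
Definition queries (x : word) p : seq word :=
  [seq query_word c | c <- init M x :: p].

Lemma eq_path_step A A' x p :
    {in queries x p, forall w, (w \in A) = (w \in A')} ->
  path (@step M A) (init M x) p -> path (@step M A') (init M x) p.
Proof.
rewrite /queries; elim: p (init M x) => //= c' p IHp c eqA /andP[st pth].
apply/andP; split; last first.
  by apply: IHp pth => w w_in; apply: eqA; rewrite inE w_in orbT.
by rewrite /step -eqA // inE eqxx.
Qed.

Lemma accepting_paths_eq A A' x p :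
    {in queries x p, forall w, (w \in A) = (w \in A')} ->
  accepting_paths M A x p -> accepting_paths M A' x p.
Proof. by move=> eqA [pth acc]; split=> //; apply: eq_path_step pth. Qed.

Lemma size_bit_prefix (s : seq (symbol (aux M))) :
  size (bit_prefix s) <= size s.
Proof. by elim: s => //= -[[b|i]|] s. Qed.

(** The head position is bounded together with the written length, since writing extends the tape up
    to the head. *)
Lemma query_tape_step A n c c' : @step M A c c' ->
    size (c.2 ord_max).1 <= n /\ (c.2 ord_max).2 <= n ->
  size (c'.2 ord_max).1 <= n.+1 /\ (c'.2 ord_max).2 <= n.+1.
Proof.
rewrite /step; case: ifP => // _; case: ifP => _.
  by move/eqP=> -> /= []; lia.
case/exists_inP=> a _ /eqP -> [le1 le2]; rewrite /act /= ffunE /=.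
rewrite size_set_nth; split; first by lia.
by case: (a.2 ord_max).2 => [[]|] /=; lia.
Qed.

Lemma size_query_le A x p : path (@step M A) (init M x) p ->
  {in queries x p, forall w, size w <= size p}.
Proof.
rewrite /queries -[size p]add0n.
have : size ((init M x).2 ord_max).1 <= 0 /\ ((init M x).2 ord_max).2 <= 0.
  by rewrite /init /= ffunE.
elim: p (init M x) 0 => [|c' p IHp] c n bd /=.
  move=> _ w; rewrite inE => /eqP ->.
  by apply: leq_trans (size_bit_prefix _) _; case: bd; lia.
case/andP=> st pth w; rewrite inE => /orP[/eqP ->|].
  by apply: leq_trans (size_bit_prefix _) _; case: bd; lia.
by rewrite addnS -addSn; apply: IHp pth w; apply: query_tape_step st bd.
Qed.

End Queries.

Definition agree (m : nat) (A A' : language) : Prop :=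
  forall w, size w < m -> (w \in A) = (w \in A').

Lemma agree_sym m A A' : agree m A A' -> agree m A' A.
Proof. by move=> eqA w /eqA. Qed.

Lemma agreeW m m' A A' : m <= m' -> agree m' A A' -> agree m A A'.
Proof. by move=> le_m eqA w lt_w; apply: eqA; apply: leq_trans lt_w le_m. Qed.

Lemma agree_accepting_paths (N : poly_machine) n : exists m, forall A A' x,
  size x < n -> agree m A A' -> accepting_paths N A x = accepting_paths N A' x.
Proof.
have [c lt_c] := path_bound N; exists (n.+2 ^ c) => A A' x lt_x.
suff sub B B' : agree (n.+2 ^ c) B B' ->
    accepting_paths N B x `<=` accepting_paths N B' x.
  by move=> eqA; apply/seteqP; split; apply: sub => //; apply: agree_sym.
move=> eqB p px; apply: (accepting_paths_eq _ px) => w w_in.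
apply: eqB; apply: leq_ltn_trans (size_query_le px.1 w_in) _.
apply: leq_trans (lt_c _ _ _ px.1) _.
by apply: leq_expn2r; lia.
Qed.

Lemma agree_sys_lang (Ns : seq poly_machine) n : exists m, forall A A',
  agree m A A' -> agree n (sys_lang A Ns) (sys_lang A' Ns).
Proof.
elim: Ns n => [|N Ns IH] n /=; first by exists n.
have [m1 eq1] := agree_accepting_paths N n.
have [m eq_m] := IH m1; exists m => A A' /eq_m eqA w lt_w.
have E := eq1 _ _ w lt_w eqA.
by apply/idP/idP => /set_mem w_in; apply/mem_set; move: w_in;
  rewrite /lang /= E.
Qed.

(** Ambiguity shows on a single input of a single machine, whose accepting paths depend only on the
    oracle up to some length. *)
Lemma not_unambiguous_agree (Ns : seq poly_machine) A : ~ unambiguous A Ns ->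
  exists m, forall A', agree m A A' -> ~ unambiguous A' Ns.
Proof.
elim: Ns => [|N Ns IH] //= /not_andP[|/IH[m Hm]]; last first.
  by exists m => A' /Hm amb [].
case/existsNP=> x amb; have [m1 eq1] := agree_accepting_paths N (size x).+1.
have [m eq_m] := agree_sys_lang Ns m1; exists m => A' /eq_m eqA [/(_ x)].
by rewrite -(eq1 _ _ x (ltnSn _) eqA).
Qed.

Lemma lang_neq_agree (Ns Ns' : seq poly_machine) A :
    sys_lang A Ns <> sys_lang A Ns' ->
  exists m, forall A', agree m A A' -> sys_lang A' Ns <> sys_lang A' Ns'.
Proof.
move=> neq; have [x neq_x] :
    exists x, (x \in sys_lang A Ns) <> (x \in sys_lang A Ns').
  apply: contrapT => /forallNP same; apply: neq.
  have {}same x : (x \in sys_lang A Ns) = (x \in sys_lang A Ns').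
    exact: contrapT (same x).
  by apply/seteqP; split=> x /mem_set x_in; apply/set_mem; move: x_in;
    rewrite same.
have [m1 eq1] := agree_sys_lang Ns (size x).+1.
have [m2 eq2] := agree_sys_lang Ns' (size x).+1.
exists (maxn m1 m2) => A' eqA E; apply: neq_x.
rewrite (eq1 _ _ (agreeW (leq_maxl _ _) eqA)) //.
by rewrite (eq2 _ _ (agreeW (leq_maxr _ _) eqA)) // E.
Qed.

(** * Counting in finite relations *)

Section Counting.
Variables T W : eqType.

Lemma count_has_le (S : W -> pred T) (s : seq T) (qs : seq W) t :
    {in qs, forall w, count (S w) s <= t} ->
  count (fun a => has (S^~ a) qs) s <= size qs * t.
Proof.
elim: qs => [|w qs IHqs] le_t /=; first by rewrite count_pred0.
rewrite mulSn; apply: leq_trans (leq_add (le_t w _) (IHqs _)); last 2 first.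
- by rewrite inE eqxx.
- by move=> v v_in; apply: le_t; rewrite inE v_in orbT.
by rewrite -count_predUI leq_addr.
Qed.

(** Double counting: the in-degrees have the same sum as the out-degrees, at most [t * size s], so
    they cannot all exceed [t]. *)
Lemma sparse_indegree (e : rel T) (s : seq T) t :
    s != [::] -> {in s, forall a, count (e a) s <= t} ->
  exists2 b, b \in s & count (e^~ b) s <= t.
Proof.
move=> s_n0 le_t; apply/hasP; apply: contraT => /hasPn gt_t.
have : \sum_(b <- s) count (e^~ b) s <= \sum_(b <- s) t.
  under eq_bigr do rewrite -sum1_count.
  under eq_bigr do rewrite big_mkcond.
  rewrite exchange_big /= big_seq [leqRHS]big_seq leq_sum // => a a_in.
  by rewrite -big_mkcond sum1_count le_t.
suff : \sum_(b <- s) t < \sum_(b <- s) count (e^~ b) s by lia.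
have : \sum_(b <- s) t.+1 <= \sum_(b <- s) count (e^~ b) s.
  by rewrite big_seq [leqRHS]big_seq leq_sum // => b /gt_t; rewrite -ltnNge.
rewrite !big_const_seq !iter_addn_0 count_predT mulSn.
by case: (s) s_n0 => //= *; lia.
Qed.

End Counting.

(** * Few words are sensitive *)

Lemma accepting_path_unique (N : poly_machine) A x p q :
    accepting_paths N A x #<= `I_1 ->
  accepting_paths N A x p -> accepting_paths N A x q -> p = q.
Proof.
move=> /pcard_leP/injfunPex[f fI inj_f] pP qP.
apply: inj_f; rewrite ?inE //.
by have := fI _ pP; have := fI _ qP; rewrite /=; lia.
Qed.

(** [V] is the pool of words that may be added; the diagonalisation takes all words of one
    length. *)
Definition locally_unambiguous (h : nat) (V : {pred word}) A
    (Ns : seq poly_machine) : Prop :=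
  forall B : seq word, {subset B <= V} -> size B <= h ->
    unambiguous (A `|` [set` B]) Ns.

Definition sensitive A Ns (y a : word) : bool :=
  (y \in sys_lang (A `|` [set a]) Ns) != (y \in sys_lang A Ns).

Definition path_sensitive A Ns (N : poly_machine) x (p : seq (config N))
    (a : word) : bool :=
  has ((sensitive A Ns)^~ a) (queries x p).

Lemma accepting_insensitive A Ns (N : poly_machine) x p a :
    ~~ path_sensitive A Ns x p a ->
  accepting_paths N (sys_lang A Ns) x p <->
  accepting_paths N (sys_lang (A `|` [set a]) Ns) x p.
Proof.
move=> /hasPn ins; split; apply: accepting_paths_eq => w /ins;
  by rewrite negbK => /eqP.
Qed.

(** Moving the base oracle to [A] plus [a] spends one word of the budget [h]; in the induction this
    matches the loss of one machine. *)
Lemma locally_unambiguous_setU1 h V A Ns a :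
    a \in V -> locally_unambiguous h.+1 V A Ns ->
  locally_unambiguous h V (A `|` [set a]) Ns.
Proof.
move=> Va unam B sB szB; have := unam (a :: B).
have -> : [set` a :: B] = [set a] `|` [set` B].
  apply/seteqP; split=> w /=; rewrite in_cons.
    by case/predU1P; [left|right].
  by case=> [->|->]; rewrite ?eqxx ?orbT.
rewrite setUA; apply=> // w; rewrite inE => /orP[/eqP -> //|]; exact: sB.
Qed.

Lemma locally_unambiguousW h V A Ns :
  locally_unambiguous h.+1 V A Ns -> locally_unambiguous h V A Ns.
Proof. by move=> unam B sB szB; apply: unam => //; apply: leqW. Qed.

Lemma locally_unambiguous0 h V A Ns :
  locally_unambiguous h V A Ns -> unambiguous A Ns.
Proof.
move=> /(_ [::]); rewrite (_ : [set` [::]] = set0) ?setU0; last first.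
  by apply/seteqP; split.
by apply.
Qed.

Lemma count_sensitive (Ns : seq poly_machine) : exists c, forall V A,
  locally_unambiguous (size Ns).+1 V A Ns ->
  forall y D, uniq D -> {subset D <= V} ->
    count (sensitive A Ns y) D <= (size y).+2 ^ c.
Proof.
elim: Ns => [|N Ns [d IH]].
  exists 0 => V A _ y D uD _; rewrite expn0.
  (* For the empty system membership of [y] can change only by adding [y] itself. *)
  apply: (@leq_trans (count (pred1 y) D)); last first.
    by rewrite count_uniq_mem ?leq_b1.
  apply: sub_count => a; rewrite /sensitive /=; apply: contraNT => neq.
  apply/eqP; apply/idP/idP => /set_mem yA; apply/mem_set; last by left.
  by case: yA => // ya; rewrite -ya eqxx in neq.
have [c lt_c] := path_bound N.
(* A path has at most [m ^ c] query words [w], each with [size w + 2 <= m ^ c.+1], hence at most [t]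
   sensitive words; the last two factors [m] absorb [1 + 3 * t]. *)
exists (c + c.+1 * d).+2 => V A unam y D uD sD.
set m := (size y).+2; set t := m ^ (c + c.+1 * d).
have t_gt0 : 0 < t by rewrite expn_gt0.
suff le_t : count (sensitive A (N :: Ns) y) D <= 1 + 3 * t.
  by rewrite !expnS -/t; apply: leq_trans le_t _; rewrite /m; nia.
have unam_tl h A' : locally_unambiguous h V A' (N :: Ns) ->
    locally_unambiguous h V A' Ns.
  by move=> unam' B sB szB; case: (unam' B sB szB).
(* Acceptance under [O] serves only to bound the length of [p], so [O] may differ from the oracle at
   which sensitivity is measured. *)
have le_path A' O p s : locally_unambiguous (size Ns).+1 V A' Ns ->
    accepting_paths N O y p -> uniq s -> {subset s <= D} ->
  count (path_sensitive A' Ns y p) s <= t.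
  move=> unam' pP us sD'; have := lt_c _ _ _ pP.1; rewrite -/m => lt_p.
  have le_w : {in queries y p, forall w,
      count (sensitive A' Ns w) s <= (m ^ c.+1) ^ d}.
    move=> w w_in; apply: leq_trans (IH V A' unam' w s us _) _.
      by move=> a /sD' /sD.
    apply: leq_expn2r; have := size_query_le pP.1 w_in.
    rewrite expnS => le_w; apply: leq_trans (leq_mul (isT : 1 < m) lt_p).
    by rewrite mul2n doubleS !ltnS (leq_trans le_w) // -addnn leq_addr.
  apply: leq_trans (count_has_le le_w) _.
  by rewrite /t expnD expnM leq_mul2r /= size_map lt_p orbT.
rewrite -size_filter; set s := [seq a <- D | _].
have us : uniq s by rewrite filter_uniq.
have sD' : {subset s <= D} by move=> a; rewrite mem_filter => /andP[].
have sens a : a \in s -> sensitive A (N :: Ns) y a.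
  by rewrite mem_filter => /andP[].
have [[p pP]|rejA] := pselect (sys_lang A (N :: Ns) y).
  have : all (path_sensitive A Ns y p) s.
    apply/allP => a /sens; apply: contraNT => /accepting_insensitive ins.
    rewrite (mem_set (A := sys_lang A _)) ?mem_set //; last by exists p.
    by exists p; apply/ins.
  rewrite all_count => /eqP <-.
  have := le_path _ _ _ s (locally_unambiguousW (unam_tl _ _ unam)) pP us sD'.
  lia.
have acc a : a \in s -> sys_lang (A `|` [set a]) (N :: Ns) y.
  move=> /sens; rewrite /sensitive (memNset rejA).
  by case: (boolP (y \in _)) => // /set_mem.
have [->//|s_n0] := eqVneq s [::].
(* The default [[::]] is never taken for [a] in [s], where an accepting path exists. *)
pose pi a : seq (config N) :=
  xget [::] (accepting_paths N (sys_lang (A `|` [set a]) Ns) y).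
have piP a : a \in s ->
    accepting_paths N (sys_lang (A `|` [set a]) Ns) y (pi a).
  by move=> /acc; apply: xgetPex.
pose e a := path_sensitive (A `|` [set a]) Ns y (pi a).
have unamU a : a \in s ->
    locally_unambiguous (size Ns).+1 V (A `|` [set a]) (N :: Ns).
  by move=> /sD' /sD Va; apply: locally_unambiguous_setU1.
(* Out-degrees of [e] are at most [t] by [le_path] at [A] plus [a]; [b] is picked with in-degree at
   most [t]. *)
have [a a_in|b b_in le_b] := @sparse_indegree _ e s t s_n0.
  by apply: le_path (piP a a_in) us sD'; apply: unam_tl; apply: unamU.
(* These four exceptional sets have at most [t], [t], 1 and [t] elements of [s]. *)
have cover : all (predU (e^~ b) (predU (e b) (predU (pred1 b)
    (path_sensitive A Ns y (pi b))))) s.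
  apply/allP => a a_in; apply: contraT.
  change (~~ [|| e a b, e b a, a == b
    | path_sensitive A Ns y (pi b) a] -> false).
  move=> /norP[/accepting_insensitive ab /norP[/accepting_insensitive ba]].
  move=> /norP[_ /accepting_insensitive ins].
  (* Both paths accept once [a] and [b] are both added; two words are within the budget, which is at
     least 2 here. *)
  have eq_pi : pi a = pi b.
    have [at1 _] := locally_unambiguous0
      (locally_unambiguous_setU1 (sD _ (sD' _ b_in)) (unamU a a_in)).
    apply: accepting_path_unique (at1 y) _ _; first by apply/ab/piP.
    by rewrite setUAC; apply/ba/piP.
  by case: rejA; exists (pi b); apply/ins; rewrite -eq_pi; apply: piP.
move: cover; rewrite all_count => /eqP <-.
have leU (P Q : pred word) : count (predU P Q) s <= count P s + count Q s.
  by rewrite -count_predUI leq_addr.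
apply: leq_trans (leU _ _) _; apply: leq_trans (leq_add le_b (leU _ _)) _.
have le_eb : count (e b) s <= t.
  by apply: le_path (piP b b_in) us sD'; apply: unam_tl; apply: unamU.
have le_last : count (path_sensitive A Ns y (pi b)) s <= t.
  apply: le_path (piP b b_in) us sD'.
  exact: locally_unambiguousW (unam_tl _ _ unam).
have le_1 : count (pred1 b) s <= 1 by rewrite count_uniq_mem ?leq_b1.
have le_tail := leq_trans (leU _ _) (leq_add le_1 le_last).
by apply: leq_trans (leq_add (leqnn t) (leq_add le_eb le_tail)) _; lia.
Qed.

(** * The guessing machine *)

Lemma set_nth_id (T : Type) (x0 : T) (s : seq T) i :
  i < size s -> set_nth x0 s i (nth x0 s i) = s.
Proof. by move=> lt_i; rewrite set_nthE lt_i -drop_nth // cat_take_drop. Qed.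

Lemma set_nth_size (T : Type) (x0 y : T) (s : seq T) :
  set_nth x0 s (size s) y = rcons s y.
Proof. by rewrite set_nthE ltnn subnn cats1. Qed.

Section GuessMachine.

Notation state := 'I_4.
Notation scanned := {ffun 'I_2 -> symbol 0}.

Definition guessing : state := Ordinal (isT : 0 < 4).
Definition accepting : state := Ordinal (isT : 1 < 4).
Definition querying : state := Ordinal (isT : 2 < 4).
Definition rejecting : state := Ordinal (isT : 3 < 4).

Definition guess_bit (s : scanned) (b : bool) :
    state * {ffun 'I_2 -> symbol 0 * option bool} :=
  (guessing, [ffun i => (if i == ord0 then s i else Some (inl b), Some true)]).

Definition guess_stop (s : scanned) :
    state * {ffun 'I_2 -> symbol 0 * option bool} :=
  (querying, [ffun i => (s i, None)]).

(** Both heads advance together, so the guess has the length of the input. The answer state [yes] is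
    the accepting state, and [no] has no instruction. *)
Definition guess_machine : oracle_machine :=
  @OracleMachine 0 0 4 guessing accepting querying accepting rejecting
    [ffun qs : state * scanned =>
       if qs.1 == guessing then
         if qs.2 ord0 is Some _ then
           [set guess_bit qs.2 true; guess_bit qs.2 false]%SET
         else [set guess_stop qs.2]%SET
       else finset.set0].

Implicit Types (A : language) (x w v : word).

Definition bits w : seq (symbol 0) := [seq Some (inl b) | b <- w].

Definition guess_config x w : config guess_machine :=
  (guessing, [ffun i : 'I_2 => (bits (if i == ord0 then x else w), size w)]).

(** The stopping instruction writes the scanned blank back, which appends an explicit [None] to both
    tapes. *)
Definition stop_config (q : state) x w : config guess_machine :=
  (q, [ffun i : 'I_2 =>
         let u := if i == ord0 then x else w in (rcons (bits u) None, size u)]).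

Lemma size_bits w : size (bits w) = size w.
Proof. exact: size_map. Qed.

Lemma guess_step A x w c : size w < size x ->
  step A (guess_config x w) c =
    (c == guess_config x (rcons w true)) ||
    (c == guess_config x (rcons w false)).
Proof.
move=> lt_w; set s := scan (guess_config x w).
have act_bit b : act (guess_config x w) (guess_bit s b) =
    guess_config x (rcons w b).
  congr (_, _); apply/ffunP => i; rewrite !ffunE /= size_rcons.
  have [_|_] := eqVneq i ord0.
    by rewrite set_nth_id ?size_bits.
  by rewrite -{1}(size_bits w) set_nth_size /bits map_rcons.
have s0 : exists b, s ord0 = Some (inl b).
  exists (nth false x (size w)); rewrite ffunE /= ffunE /=.
  by rewrite (nth_map false).
case: s0 => b0 s0.
have stepE : step A (guess_config x w) c =
    [exists a in [set guess_bit s true; guess_bit s false]%SET,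
       c == act (guess_config x w) a].
  by rewrite /step /= ffunE /= -/s s0.
rewrite stepE; apply/exists_inP/orP => [[a]|[] /eqP ->].
- by rewrite !finset.inE => /orP[] /eqP -> /eqP ->; [left|right];
    rewrite act_bit.
- by exists (guess_bit s true); rewrite ?act_bit // !finset.inE eqxx.
- by exists (guess_bit s false); rewrite ?act_bit // !finset.inE eqxx orbT.
Qed.

Lemma guess_step_stop A x w c : size w = size x ->
  step A (guess_config x w) c = (c == stop_config querying x w).
Proof.
move=> eq_sz; set s := scan (guess_config x w).
have act_stop : act (guess_config x w) (guess_stop s) =
    stop_config querying x w.
  congr (_, _); apply/ffunP => i; rewrite !ffunE /=.
  set u := if _ then _ else _.
  have -> : size w = size u by rewrite /u; case: ifP.
  by rewrite -(size_bits u) nth_default // set_nth_size.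
have s0 : s ord0 = None.
  by rewrite ffunE /= ffunE /= nth_default // size_bits eq_sz.
have stepE : step A (guess_config x w) c =
    [exists a in [set guess_stop s]%SET, c == act (guess_config x w) a].
  by rewrite /step /= ffunE /= -/s s0.
rewrite stepE; apply/exists_inP/eqP => [[a]|->].
  by rewrite !finset.inE => /eqP -> /eqP ->.
by exists (guess_stop s); rewrite ?act_stop // finset.inE.
Qed.

Lemma bit_prefix_bits w : @bit_prefix guess_machine (rcons (bits w) None) = w.
Proof. by elim: w => //= b w ->. Qed.

Lemma guess_step_query A x w c :
  step A (stop_config querying x w) c =
    (c == stop_config (if w \in A then accepting else rejecting) x w).
Proof. by rewrite /step /= /query_word ffunE /= bit_prefix_bits. Qed.

Lemma guess_step_halt A q x w c : q \in [:: accepting; rejecting] ->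
  step A (stop_config q x w) c = false.
Proof.
rewrite !inE => /orP[] /eqP ->; rewrite /step //=.
by apply/negbTE/exists_inPn => a; rewrite ffunE /= finset.inE.
Qed.

Fixpoint guess_run x w v : seq (config guess_machine) :=
  if v is b :: v' then
    guess_config x (rcons w b) :: guess_run x (rcons w b) v'
  else [:: stop_config querying x w; stop_config accepting x w].

(** Induction on the number of bits still to guess. The 2 accounts for the stopping step and the
    query. *)
Lemma guess_path A x w p : size w <= size x ->
    path (@step guess_machine A) (guess_config x w) p ->
  size p <= size x - size w + 2 /\
  ((last (guess_config x w) p).1 = accepting ->
   exists v, [/\ size (w ++ v) = size x, A (w ++ v) & p = guess_run x w v]).
Proof.
move=> le_w; move: {2}(size x - size w) (erefl (size x - size w)) => n.
elim: n w p le_w => [|n IHn] w [|c p] le_w eq_n //=.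
  have eq_sz : size w = size x by lia.
  rewrite guess_step_stop // => /andP[/eqP -> {c}].
  case: p => [|c p] /=; first by split=> //; lia.
  rewrite guess_step_query => /andP[/eqP -> {c}].
  case: p => [|c p] /=; last by rewrite guess_step_halt //; case: ifP.
  move=> _; split; first by lia.
  case: ifP => // /set_mem wA _; exists [::]; rewrite cats0.
  by split=> //=.
have lt_w : size w < size x by lia.
rewrite guess_step // => /andP[/orP st].
have {st} [b ->] : exists b, c = guess_config x (rcons w b).
  by case: st => /eqP ->; [exists true|exists false].
move=> pth; have [] := IHn (rcons w b) p _ _ pth;
  rewrite ?size_rcons; [lia|lia|].
move=> le_p runP; split; first by lia.
by move=> /runP[v [sz wA ->]]; exists (b :: v); rewrite -cat_rcons.
Qed.

Lemma guess_runP A x w v : size (w ++ v) = size x -> A (w ++ v) ->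
  path (@step guess_machine A) (guess_config x w) (guess_run x w v) /\
  (last (guess_config x w) (guess_run x w v)).1 = accepting.
Proof.
elim: v w => [|b v IHv] w /=.
  rewrite cats0 => eq_sz wA; split=> //.
  by rewrite guess_step_stop // guess_step_query mem_set ?eqxx.
rewrite -cat_rcons => eq_sz wA; have [pth acc] := IHv _ eq_sz wA.
split=> //; rewrite pth andbT guess_step; last first.
  by move: eq_sz; rewrite size_cat size_rcons; lia.
by case: (b); rewrite eqxx ?orbT.
Qed.

Lemma guess_init x : init guess_machine x = guess_config x [::].
Proof.
congr (_, _); apply/ffunP => i; rewrite !ffunE; by case: (i == ord0).
Qed.

Lemma guess_accepting_paths A x :
  accepting_paths guess_machine A x =
    guess_run x [::] @` [set v | A v /\ size v = size x].
Proof.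
rewrite /accepting_paths guess_init; apply/seteqP; split=> p /=.
  case=> pth acc.
  have [_ /(_ acc) [v [sz vA ->]]] :=
    guess_path (leq0n _ : size [::] <= size x) pth.
  by exists v.
by case=> v [vA sz] <-; apply: guess_runP.
Qed.

Lemma guess_poly_time : poly_time guess_machine.
Proof.
exists ('X + 2%:P)%R => A x p; rewrite guess_init => pth.
have [le_p _] := guess_path (leq0n _ : size [::] <= size x) pth.
rewrite hornerD hornerX hornerC; change (size p <= size x + 2).
by rewrite subn0 in le_p.
Qed.

Definition guess : poly_machine := PolyMachine guess_poly_time.

Lemma lang_guess A x : lang guess A x <-> exists2 v, A v & size v = size x.
Proof.
rewrite /lang /= guess_accepting_paths; split.
  by case=> _ [v [vA sz] _]; exists v.
by case=> v vA sz; exists (guess_run x [::] v); exists v.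
Qed.

End GuessMachine.

(** * Sparse oracles and numbering of systems *)

Definition sparse (h : nat) (A : language) : Prop :=
  forall n, exists2 s : seq word, size s <= h &
    forall w, A w -> size w = n -> w \in s.

Lemma guess_at_most_paths h A : sparse h A -> at_most_paths h A guess.
Proof.
move=> spA x; have [s le_s sA] := spA (size x).
rewrite guess_accepting_paths; apply: card_le_trans (card_image_le _ _) _.
(* The position in the covering list [s] injects the slice into [I_h]. *)
apply/pcard_leP/injfunPex; exists (index^~ s).
  by move=> v [vA sz] /=; rewrite (leq_trans _ le_s) // index_mem sA.
move=> v w /set_mem[vA szv] /set_mem[wA szw] eq_i.
by rewrite -(nth_index [::] (sA v vA szv)) eq_i nth_index // sA.
Qed.

(** As a nested dependent sum over finite types this is a countable type, so [pickle] numbers the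
    machines. *)
Definition machine_data := {w : nat & {a : nat & {n : nat &
  ('I_n * 'I_n * 'I_n * 'I_n * 'I_n *
   {ffun 'I_n * {ffun 'I_w.+2 -> symbol a} ->
      {set 'I_n * {ffun 'I_w.+2 -> symbol a * option bool}}})%type}}}.

Definition data_of_machine (M : oracle_machine) : machine_data :=
  existT _ (Defs.work M) (existT _ (aux M) (existT _ (nstates M)
    (Defs.start M, accept M, query M, yes M, Defs.no M, delta M))).

Definition machine_of_data (d : machine_data) : oracle_machine :=
  let: existT w (existT a (existT n (s, ac, q, y, r, dl))) := d in
  @OracleMachine w a n s ac q y r dl.

Lemma data_of_machineK : cancel data_of_machine machine_of_data.
Proof. by case. Qed.

Definition machine_code (N : poly_machine) : nat :=
  pickle (data_of_machine N).

(** The code forgets the proof of polynomial time; proof irrelevance restores injectivity. *)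
Lemma machine_code_inj : injective machine_code.
Proof.
move=> [M pM] [M' pM'] /(pcan_inj pickleK)/(can_inj data_of_machineK) /= eqM.
by case: M' / eqM pM' => pM'; rewrite (Prop_irrelevance pM pM').
Qed.

Definition system_code (Ns : seq poly_machine) : nat :=
  pickle [seq machine_code N | N <- Ns].

Lemma system_code_inj : injective system_code.
Proof.
by move=> Ns Ns' /(pcan_inj pickleK)/(inj_map machine_code_inj).
Qed.

(** * Finite-extension diagonalisation *)

Definition defeats (O : language) (Ns : seq poly_machine) : Prop :=
  ~ (unambiguous O Ns /\ lang guess O = sys_lang O Ns).

Definition bounded (m : nat) (A : language) : Prop :=
  forall w, A w -> size w < m.

Lemma defeats_agree Ns A : defeats A Ns ->
  exists m, forall O, agree m A O -> defeats O Ns.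
Proof.
move=> /not_andP[/not_unambiguous_agree|/(@lang_neq_agree [:: guess])] [m Hm];
  by exists m => O /Hm ? [].
Qed.

Lemma exists_defeating_extension A m Ns : bounded m A ->
  exists (B : seq word) (n : nat), [/\ m <= n, {in B, forall w, size w = n},
    size B <= (size Ns).+1 & defeats (A `|` [set` B]) Ns].
Proof.
move=> bdA; have [c le_c] := count_sensitive Ns.
(* As [m <= n], the oracle [A] has no word of length [n], and the [2 ^ n] words of that length
   outnumber the sensitive ones. *)
have [n le_mn lt_n] := expn_lt_exp2 c m.
apply: contrapT => none.
have good B : {in B, forall w, size w = n} -> size B <= (size Ns).+1 ->
    unambiguous (A `|` [set` B]) Ns /\
    lang guess (A `|` [set` B]) = sys_lang (A `|` [set` B]) Ns.
  by move=> szB leB; apply: contrapT => bad; apply: none; exists B, n.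
pose V : {pred word} := [pred w | size w == n].
have unam : locally_unambiguous (size Ns).+1 V A Ns.
  by move=> B BV leB; apply: (good B _ leB).1 => w /BV /eqP.
pose D : seq word := [seq val t | t <- enum {: n.-tuple bool}].
have uD : uniq D by rewrite map_inj_uniq ?enum_uniq //; apply: val_inj.
have szD w : w \in D -> size w = n by case/mapP=> t _ ->; rewrite size_tuple.
have := le_c V A unam (nseq n false) D uD (fun w => introT eqP \o szD w).
rewrite size_nseq.
suff -> : count (sensitive A Ns (nseq n false)) D = 2 ^ n by lia.
have <- : size D = 2 ^ n by rewrite size_map -cardE card_tuple card_bool.
apply/eqP; rewrite -all_count; apply/allP => a /szD sz_a.
rewrite /sensitive.
have -> : nseq n false \in sys_lang (A `|` [set a]) Ns.
  have [//|//|_] := good [:: a].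
    by move=> w; rewrite inE => /eqP ->.
  have -> : [set` [:: a]] = [set a].
    by apply/seteqP; split=> w /=; rewrite inE => /eqP.
  move=> <-; apply/mem_set/lang_guess; exists a; first by right.
  by rewrite size_nseq.
suff /negPf -> : nseq n false \notin sys_lang A Ns by [].
apply/negP => /set_mem.
have [//|//|_] := good [::].
have -> : [set` [::]] = set0 :> language by apply/seteqP; split.
rewrite setU0 => <- /lang_guess[v /bdA]; rewrite size_nseq; lia.
Qed.

(** Old words are shorter than [m <= n], so no slice receives both old and new words. *)
Lemma sparse_setU h A m (B : seq word) n : bounded m A -> sparse h A ->
    m <= n -> {in B, forall w, size w = n} -> size B <= h ->
  sparse h (A `|` [set` B]).
Proof.
move=> bdA spA le_mn szB leB l; have [s le_s sA] := spA l.
have [->|ne_l] := eqVneq l n.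
  by exists B => // w [/bdA|//] lt_w sz_w; move: lt_w; lia.
by exists s => // w [/sA //|/szB ->] eq_l; rewrite eq_l eqxx in ne_l.
Qed.

Record stage (h : nat) : Type := Stage {
  stage_lang : language;
  stage_bound : nat;
  stage_sparse : sparse h stage_lang;
  stage_bounded : bounded stage_bound stage_lang
}.

(** The bound separates settled lengths from free ones. Quantifying over all [O] that agree below
    the new bound makes the defeat survive later stages. *)
Definition next_stage k s (st st' : stage k.+1) : Prop :=
  [/\ stage_bound st < stage_bound st',
      agree (stage_bound st) (stage_lang st) (stage_lang st') &
      forall Ns, size Ns = k -> system_code Ns = s ->
      forall O, agree (stage_bound st') (stage_lang st') O -> defeats O Ns].

Lemma exists_next_stage k s (st : stage k.+1) : exists st', next_stage s st st'.
Proof.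
case: st => A m spA bdA.
have [[Ns [szNs codeNs]]|none] := pselect (exists Ns : seq poly_machine,
    size Ns = k /\ system_code Ns = s); last first.
  have bdA' : bounded m.+1 A by move=> w /bdA/ltnW.
  exists (Stage spA bdA'); split=> // Ns szNs codeNs.
  by case: none; exists Ns.
have [B [n [le_mn szB leB /defeats_agree[m1 def]]]] :=
  exists_defeating_extension Ns bdA.
(* [m1] protects the defeat, and [n.+1] puts the bound above the added words and above [m]. *)
pose A' := A `|` [set` B]; pose m' := maxn m1 n.+1.
have spA' : sparse k.+1 A'.
  by apply: (sparse_setU bdA spA le_mn szB); rewrite -szNs.
have bdA' : bounded m' A'.
  move=> w [/bdA lt_w|/szB ->]; rewrite leq_max ltnS ?leqnn ?orbT //.
  by rewrite (leq_trans (ltnW lt_w)) ?orbT.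
exists (Stage spA' bdA'); split=> /=.
- by rewrite /m'; lia.
- move=> w lt_w; apply/idP/idP => /set_mem wA.
    by apply/mem_set; left.
  by case: wA => [/mem_set //|/szB sz_w]; rewrite sz_w ltnNge le_mn in lt_w.
- move=> Ns' _ codeNs' O agO.
  rewrite (system_code_inj (etrans codeNs' (esym codeNs))).
  exact/def/(agreeW (leq_maxl _ _) agO).
Qed.

Lemma USigma_gt0 k A L : 0 < k -> USigma k A L ->
  exists Ns : k.-tuple poly_machine, unambiguous A Ns /\ L = sys_lang A Ns.
Proof. by case: k. Qed.

Theorem theorem4p1 (k : nat) (hk : 1 <= k) :
  exists A : language, ~ (UP_le k.+1 A `<=` USigma k A).
Proof.
have sp0 : sparse k.+1 set0 by move=> n; exists [::].
have bd0 : bounded 0 set0 by [].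
have [nxt nxtP] :=
  choice (fun p : nat * stage k.+1 => exists_next_stage p.1 p.2).
pose st := fix st s : stage k.+1 :=
  if s is s'.+1 then nxt (s', st s') else Stage sp0 bd0.
have stP s : next_stage s (st s) (st s.+1) := nxtP (s, st s).
have st_mono s t : s <= t -> stage_bound (st s) <= stage_bound (st t) /\
    agree (stage_bound (st s)) (stage_lang (st s)) (stage_lang (st t)).
  elim: t => [|t IHt]; first by rewrite leqn0 => /eqP ->.
  rewrite leq_eqVlt => /predU1P[->//|/IHt[le_b ag_b]].
  have [lt_b ag_t _] := stP t; split; first by lia.
  by move=> w lt_w; rewrite ag_b // ag_t //; lia.
have le_bound s : s <= stage_bound (st s).
  by elim: s => // s IHs; have [lt_b _ _] := stP s; lia.
(* By [le_bound], stage [(size w).+1] has already settled [w], so [O] is the limit of the stages. *)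
pose O : language := [set w | stage_lang (st (size w).+1) w].
have agO s : agree (stage_bound (st s)) (stage_lang (st s)) O.
  move=> w lt_w; have -> : (w \in O) = (w \in stage_lang (st (size w).+1)).
    by apply/idP/idP => /set_mem ?; apply/mem_set.
  by case: (leqP s (size w).+1) => [/st_mono[_ ->//]|/ltnW/st_mono[_ ->//]].
exists O => sub.
have spO : sparse k.+1 O.
  move=> n; have [s le_s sA] := stage_sparse (st n.+1) n.
  exists s => // w wO sz_w.
  by apply: sA => //; rewrite -sz_w.
have /sub : UP_le k.+1 O (lang guess O).
  by exists guess; split=> //; apply: guess_at_most_paths.
case/(USigma_gt0 hk)=> Ns [unam eq_lang].
(* The step indexed by the code of [Ns] defeats [Ns] at every oracle extending it, in particular at
   [O]. *)
have [_ _ def] := stP (system_code Ns).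
exact: def (size_tuple Ns) erefl O (agO _) (conj unam eq_lang).
Qed.
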